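(* Let $\boldsymbol f^*\in\mathbb R^n$ be a (piecewise constant) vector, $\sigma^*>0$, $\boldsymbol y=\boldsymbol f^*+\boldsymbol\xi$ with $\boldsymbol\xi\sim\mathcal N_n(0,\sigma^{*2}\mathbf I_n)$, and $\delta\in(0,1)$. If the tuning parameter satisfies $\lambda=2\sigma^*\{(2/n)\log(n/\delta)\}^{1/2}$, then on an event of probability at least $1-2\delta$ the following bound holds for every nonempty $T\subset[n]$: $$\frac1n\|\widehat{\boldsymbol f}^{\rm TV}-\boldsymbol f^*\|_2^2\le\inf_{\bar{\boldsymbol f}\in\mathbb R^n}\Big\{\frac1n\|\bar{\boldsymbol f}-\boldsymbol f^*\|_2^2+4\lambda\|\bar{\boldsymbol f}_{T^c}\|_{\rm TV}\Big\}+\frac{4\sigma^{*2}|T|\log(n/\delta)}{n}\cdot r_{n,T},$$ where $r_{n,T}=3+256\big(\log(n)+n/\Delta_{\min,T}\big)$.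
   Context: $[n]=\{1,\dots,n\}$, $T^c=[n]\setminus T$. For $\boldsymbol f\in\mathbb R^n$, $\|\boldsymbol f\|_{\rm TV}=\sum_{i=1}^n|f_i-f_{i-1}|$ with the convention $f_0=0$, and $\|\boldsymbol f_{T^c}\|_{\rm TV}=\sum_{i\in T^c}|f_i-f_{i-1}|$. The TV-estimator is $\widehat{\boldsymbol f}^{\rm TV}\in\arg\min_{\boldsymbol f\in\mathbb R^n}\{\frac1{2n}\|\boldsymbol y-\boldsymbol f\|_2^2+\lambda\|\boldsymbol f\|_{\rm TV}\}$; equivalently, $\widehat{\boldsymbol f}^{\rm TV}=\mathbf X\widehat{\boldsymbol\beta}_\lambda$ with $\widehat{\boldsymbol\beta}_\lambda\in\arg\min_{\boldsymbol\beta}\{\frac1{2n}\|\boldsymbol y-\mathbf X\boldsymbol\beta\|_2^2+\lambda\|\boldsymbol\beta\|_1\}$ and $\mathbf X=(\mathbf 1\{i\ge j\})_{i,j\in[n]}$. $\Delta_{\min,T}$ is the smallest distance between two consecutive distinct elements of $T\cup\{1,n+1\}$. ''Piecewise constant'' imposes no quantitative restriction on the vector. *)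

(* Defs.v *)
From HB Require Import structures.
From mathcomp Require Import all_boot all_order all_algebra.
From mathcomp Require Import all_classical all_reals all_analysis.

Set Implicit Arguments.
Unset Strict Implicit.
Unset Printing Implicit Defensive.

Import Order.TTheory GRing.Theory Num.Theory.
Import numFieldNormedType.Exports.

Local Open Scope classical_set_scope.
Local Open Scope ring_scope.

(* Indices are shifted by one: i : 'I_n stands for i + 1 in [n] = {1, ..., n}
   and f 0 i (row 0, column i) for the coordinate f_(i+1) of f. *)

Section TotalVariation.
Variables (R : realType) (n : nat).
Implicit Types (f y : 'rV[R]_n) (S : {set 'I_n}).

Definition sqnorm2 f : R := \sum_(i < n) f 0 i ^+ 2.

(* The value before the first coordinate is 0, so the first jump is the first
   coordinate itself; for i > 0, ord_pred i is i - 1. *)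
Definition jump f (i : 'I_n) : R :=
  f 0 i - (if (i : nat) == 0%N then 0 else f 0 (ord_pred i)).

Definition tv f : R := \sum_(i < n) `|jump f i|.

Definition tv_on S f : R := \sum_(i in S) `|jump f i|.

Definition tv_objective (lambda : R) y f : R :=
  (2 * n%:R)^-1 * sqnorm2 (y - f) + lambda * tv f.

End TotalVariation.

Definition argmin (R : realType) (V : Type) (F : V -> R) : set V :=
  [set x | forall z, F x <= F z].

Section Spacing.
Variable n : nat.

(* T together with the points 1 and n + 1; after the shift of indices the
   latter two are 0 and n. *)
Definition knots (T : {set 'I_n}) : {set 'I_n.+1} :=
  ord0 |: (ord_max |: [set widen_ord (leqnSn n) i | i in T]%SET).

Definition consecutive (K : {set 'I_n.+1}) (a b : 'I_n.+1) : bool :=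
  [&& a \in K, b \in K, (a < b)%N & [forall c in K, ~~ (a < c < b)%N]].

(* The gaps of knots T are at most n, so the neutral element n of the minimum
   does not affect its value. *)
Definition min_spacing (T : {set 'I_n}) : nat :=
  \big[minn/n]_(p : 'I_n.+1 * 'I_n.+1 | consecutive (knots T) p.1 p.2)
    (p.2 - p.1)%N.

End Spacing.

Section GaussianNoise.
Context (d : measure_display) (Omega : measurableType d) (R : realType)
  (P : probability Omega R) (n : nat).

Definition mutually_independent (X : 'I_n -> {RV P >-> R}) : Prop :=
  forall (J : {set 'I_n}) (A : 'I_n -> set R), (forall i, measurable (A i)) ->
    P [set w | forall i, i \in J -> A i (X i w)] =
    (\prod_(i in J) P (X i @^-1` A i))%E.

(* The coordinates of X form a vector with law N_n(0, sigma^2 I_n); sigma is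
   the standard deviation, as in normal_prob. *)
Definition isotropic_gaussian (sigma : R) (X : 'I_n -> {RV P >-> R}) : Prop :=
  mutually_independent X /\
  forall (i : 'I_n) (A : set R), measurable A ->
    distribution P (X i) A = normal_prob 0 sigma A.

End GaussianNoise.

Definition tv_rate (R : realType) (n : nat) (T : {set 'I_n}) : R :=
  3 + 256 * (ln n%:R + n%:R / (min_spacing T)%:R).

(* Main.v *)
Require Import Defs.
From HB Require Import structures.
From mathcomp Require Import all_boot all_order all_algebra.
From mathcomp Require Import all_classical all_reals all_analysis.
From mathcomp Require Import measurable_realfun zify ring lra.

Import Order.TTheory GRing.Theory Num.Theory.
Import numFieldNormedType.Exports.

Local Open Scope classical_set_scope.
Local Open Scope ring_scope.

(** The estimator is compared with an arbitrary vector f. Optimality of fhat and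
convexity of the objective give ([basic_inequality])
  |fhat - fstar|^2 + |u|^2 <= |f - fstar|^2 + 2 <xi, u> + 2 K (TV f - TV fhat)
with u = fhat - f and K = n lambda, and TV f - TV fhat is at most
TV_T u - TV_Tc u + 2 TV_Tc f. It remains to bound
  2 <xi, u> + 2 K (TV_T u - TV_Tc u) - |u|^2
by a multiple of |T|, uniformly in u and T, on one event.

The event ([interval_sums_event]) bounds every sum of the noise over an interval
of length m by tau sqrt m, with tau = 2 sigma sqrt (log (n / delta)). A sum of m
independent centred Gaussian variables obeys a Chernoff bound, each of the at
most n^2 intervals fails with probability at most 2 (delta / n)^2, and
2 delta^2 <= 2 delta. The event does not depend on T. In terms of tau,
K = tau sqrt (2 n).

On the event the remainder is bounded by duality ([dual_certificate]). Write v
for the jumps of u and S_j for the sum of the noise from j on, so that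
<xi, u> = sum_j S_j v_j. If q vanishes at the end, q_t = S_t + K sg v_t at each
t in T and |S_j - q_j| <= K elsewhere, then
<xi, u> + K (TV_T u - TV_Tc u) <= sum_j q_j v_j, and summation by parts turns the
right-hand side into sum_i (q_i - q_(i+1)) u_i. Hence the remainder is at most
sum_i (q_i - q_(i+1))^2.

The certificate is q_j = sum_(t in T) (S_t + K sg v_t) psi |j - t| where psi is a
bump: psi 0 = 1, psi vanishes from half the minimal spacing Delta on, and in
between psi k is 1 - (5/2) sqrt (k / n) - 2 k / Delta, cut off at 0. The linear
term separates the supports of the bumps at distinct points of T. The square
root leaves room for the noise: |S_j - S_t| can be as large as tau sqrt |j - t|,
whereas S_j itself is at most tau sqrt n = K / sqrt 2, and the strict gap between
tau sqrt n and K pays for the difference ([bump_sqrt_le]). The energy of a bump,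
sum_k (psi k - psi (k+1))^2, is of order 1 / Delta + (log n) / n
([bump_energy]), the logarithm being the harmonic sum of the squared increments of
the square root. Since the squared heights are of order K^2, which is of order
n sigma^2 log (n / delta), the energy of q is of order
|T| sigma^2 log (n / delta) (log n + n / Delta)
([noise_compatibility_bound], [remainder_le_rate]). *)

Set Implicit Arguments.
Unset Strict Implicit.
Unset Printing Implicit Defensive.

(** * Moment generating functions *)

(** The density is almost everywhere a Radon-Nikodym derivative, for which the
change of variables is known. *)
Lemma ge0_integral_normal_prob (R : realType) (m sigma : R) (f : R -> \bar R) :
  (forall x, (0 <= f x)%E) -> measurable_fun [set: R] f ->
  (\int[normal_prob m sigma]_x f x =
   \int[lebesgue_measure]_x (f x * (normal_pdf m sigma x)%:E))%E.
Proof.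
move=> f0 mf.
have dom := @normal_prob_dominates R m sigma.
rewrite -(@Radon_Nikodym_SigmaFinite.change_of_variables _ _ _ _ _ dom) //.
have mpdf : measurable_fun [set: R] (fun x => (normal_pdf m sigma x)%:E).
  by apply/measurable_EFinP; exact: measurable_normal_pdf.
have mrn : measurable_fun [set: R]
    (Radon_Nikodym_SigmaFinite.f (normal_prob m sigma) lebesgue_measure).
  exact: measurable_int (Radon_Nikodym_SigmaFinite.f_integrable dom).
apply: ae_eq_integral => //; try exact: emeasurable_funM.
apply: ae_eqe_mul2l.
apply: integral_ae_eq => //.
- exact: Radon_Nikodym_SigmaFinite.f_integrable.
- by move=> A _ mA; rewrite -Radon_Nikodym_SigmaFinite.f_integral.
Qed.

(** Completing the square: the exponential weight shifts the centred density to
one of mean [r * sigma ^+ 2], whose integral is 1. *)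
Lemma mmt_gen_normal (R : realType) (d : measure_display)
    (Omega : measurableType d) (P : probability Omega R) (X : {RV P >-> R})
    (sigma : R) (hsigma : 0 < sigma) :
  (forall A, measurable A -> distribution P X A = normal_prob 0 sigma A) ->
  forall r, 'M_P X r = (expR (r ^+ 2 * sigma ^+ 2 / 2))%:E.
Proof.
move=> law r; rewrite /mmt_gen_fun unlock.
have mer : measurable_fun [set: R] (fun x : R => (expR (r * x))%:E : \bar R).
  apply/measurable_EFinP; exact: measurableT_comp.
have er0 (x : R) : (0 <= (expR (r * x))%:E)%E by rewrite lee_fin expR_ge0.
(* [normal_prob] lives on the sigma-algebra generated by half-open intervals,
   so [X] has to be seen as a variable with values in that space. *)
have mX : measurable_fun [set: Omega] (X : Omega -> measurableTypeR R).
  exact: (measurable_funPT X).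
pose X' : {mfun Omega >-> measurableTypeR R} :=
  HB.pack (X : Omega -> measurableTypeR R) (isMeasurableFun.Build _ _ _ _ _ mX).
transitivity (\int[distribution P X']_x (expR (r * x))%:E)%E.
  rewrite ge0_integral_distribution //.
  by apply: eq_integral => w _ /=; rewrite mulrC.
transitivity (\int[normal_prob 0 sigma]_x (expR (r * x))%:E)%E.
  apply: eq_measure_integral => A mA _; exact: law.
rewrite ge0_integral_normal_prob //.
have s0 : sigma != 0 by rewrite gt_eqF.
transitivity (\int[lebesgue_measure]_x ((expR (r ^+ 2 * sigma ^+ 2 / 2))%:E *
    (normal_pdf (r * sigma ^+ 2) sigma x)%:E))%E.
  apply: eq_integral => x _; rewrite !normal_pdfE // -!EFinM; congr EFin.
  rewrite mulrCA [RHS]mulrCA; congr (_ * _); rewrite /normal_fun -!expRD.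
  by congr expR; rewrite -mulr_natr; field.
rewrite ge0_integralZl //.
- by rewrite integral_normal_pdf mule1.
- by apply/measurable_EFinP; exact: measurable_normal_pdf.
- by move=> x _; rewrite lee_fin normal_pdf_ge0.
Qed.

(** A measure on the plane is determined by rectangles. The event [C] is carried
along so that independence of later variables survives when two variables are
replaced by a function of them. *)
Lemma joint_law (R : realType) (d : measure_display)
    (Omega : measurableType d) (P : probability Omega R) (X Y : {RV P >-> R})
    (C : set Omega) : measurable C ->
  (forall A B : set R, measurable A -> measurable B ->
    P (X @^-1` A `&` Y @^-1` B `&` C) =
    P (X @^-1` A) * P (Y @^-1` B) * P C)%E ->
  forall D : set (R * R), measurable D ->
  (P ((fun w => (X w, Y w)) @^-1` D `&` C) =
   (distribution P X \x distribution P Y) D * P C)%E.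
Proof.
move=> mC indep D mD.
have mXY : measurable_fun [set: Omega] (fun w => (X w, Y w)).
  exact/measurable_fun_pair.
pose XY : {mfun Omega >-> (R * R)%type} :=
  HB.pack (fun w => (X w, Y w)) (isMeasurableFun.Build _ _ _ _ _ mXY).
have c0 : 0 <= fine (P C) by exact: fine_ge0.
have cE : ((fine (P C))%:E = P C)%E by rewrite fineK // fin_num_measure.
pose c : {nonneg R} := NngNum c0.
transitivity ((mscale c (distribution P X) \x distribution P Y) D)%E.
  apply/esym; apply: (@product_measure_unique _ _ _ _ _ _ _
    [the measure _ _ of pushforward (mrestr P mC) XY]) => // A B mA mB.
  rewrite -[LHS]/(P (X @^-1` A `&` Y @^-1` B `&` C)).
  rewrite -[RHS]/((fine (P C))%:E * P (X @^-1` A) * P (Y @^-1` B))%E.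
  by rewrite indep // cE muleC muleA.
transitivity (mscale c (distribution P X \x distribution P Y)%E D); last first.
  by rewrite /mscale /= cE muleC.
apply: product_measure_unique => // A B mA mB.
rewrite -[LHS]/((fine (P C))%:E * (distribution P X \x distribution P Y) (A `*` B))%E.
rewrite -[RHS]/((fine (P C))%:E * P (X @^-1` A) * P (Y @^-1` B))%E.
by rewrite product_measure1E // muleA.
Qed.

Lemma mmt_gen_indepD (R : realType) (d : measure_display)
    (Omega : measurableType d) (P : probability Omega R) (X Y : {RV P >-> R}) :
  (forall A B : set R, measurable A -> measurable B ->
    P (X @^-1` A `&` Y @^-1` B) = P (X @^-1` A) * P (Y @^-1` B))%E ->
  forall r, 'M_P (X \+ Y) r = ('M_P X r * 'M_P Y r)%E.
Proof.
move=> indep r; rewrite /mmt_gen_fun unlock.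
have mer : measurable_fun [set: R] (fun x : R => (expR (x * r))%:E : \bar R).
  apply/measurable_EFinP; apply: measurableT_comp => //.
  exact: mulrr_measurable.
have er0 (x : R) : (0 <= (expR (x * r))%:E)%E by rewrite lee_fin expR_ge0.
have mXY : measurable_fun [set: Omega] (fun w => (X w, Y w)).
  exact/measurable_fun_pair.
pose g (p : R * R) : \bar R := (expR ((p.1 + p.2) * r))%:E.
have mg : measurable_fun [set: R * R] g.
  apply/measurable_EFinP; apply: measurableT_comp => //.
  apply: measurable_funM => //.
  exact: measurable_funD.
have g0 p : (0 <= g p)%E by rewrite lee_fin expR_ge0.
pose XY : {mfun Omega >-> (R * R)%type} :=
  HB.pack (fun w => (X w, Y w)) (isMeasurableFun.Build _ _ _ _ _ mXY).
transitivity (\int[distribution P XY]_p g p)%E.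
  by rewrite ge0_integral_distribution.
transitivity (\int[distribution P X \x distribution P Y]_p g p)%E.
  apply: eq_measure_integral => D mD _.
  rewrite -[LHS]/(P ((fun w => (X w, Y w)) @^-1` D)).
  have := @joint_law _ _ _ P X Y _ measurableT _ _ mD.
  rewrite setIT probability_setT mule1; apply=> A B mA mB.
  by rewrite setIT mule1 indep.
rewrite fubini_tonelli1 //.
transitivity (\int[distribution P X]_x ((expR (x * r))%:E *
    \int[distribution P Y]_y (expR (y * r))%:E))%E.
  apply: eq_integral => x _; rewrite /fubini_F -ge0_integralZl //.
  by apply: eq_integral => y _; rewrite /g /= mulrDl expRD EFinM.
rewrite ge0_integralZr //; last exact: integral_ge0.
by rewrite !ge0_integral_distribution.
Qed.

(** * Sums of independent Gaussian variables *)

Section IndependentSums.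
Context (R : realType) (d : measure_display) (Omega : measurableType d)
  (P : probability Omega R) (n : nat).
Implicit Types (xi : 'I_n -> {RV P >-> R}) (s : seq 'I_n) (J : {set 'I_n}).

Definition partial_sum xi s : Omega -> R := fun w => \sum_(i <- s) xi i w.

Lemma measurable_partial_sum xi s : measurable_fun setT (partial_sum xi s).
Proof. by apply: measurable_sum => i; exact: measurable_funPT. Qed.

HB.instance Definition _ xi s :=
  isMeasurableFun.Build _ _ _ _ (partial_sum xi s) (measurable_partial_sum xi s).

Definition cylinder xi J (A : 'I_n -> set R) : set Omega :=
  [set w | forall i, i \in J -> A i (xi i w)].

Lemma cylinder_bigcap xi J A :
  cylinder xi J A = \bigcap_(i in [set i | i \in J]) (xi i @^-1` A i).
Proof. by []. Qed.

Lemma measurable_cylinder xi J A :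
  (forall i, measurable (A i)) -> measurable (cylinder xi J A).
Proof.
move=> mA; rewrite cylinder_bigcap; apply: fin_bigcap_measurable => // i _.
by rewrite -[X in measurable X]setTI; exact: measurable_funPT.
Qed.

(** Mutual independence is given for cylinders only. Induction on [s] transfers it
to sums: the law of the pair formed by the new term and the previous sum,
restricted to the cylinder, is a multiple of a product measure, and the multiple
is the only place where the cylinder enters. *)
Lemma partial_sum_indep xi s J (A : 'I_n -> set R) (B : set R) :
  mutually_independent xi -> uniq s -> (forall i, i \in s -> i \notin J) ->
  (forall i, measurable (A i)) -> measurable B ->
  (P (partial_sum xi s @^-1` B `&` cylinder xi J A) =
   P (partial_sum xi s @^-1` B) * P (cylinder xi J A))%E.
Proof.
move=> indep; elim: s J A B => [|x s IH] J A B /=.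
  move=> _ _ mA mB.
  have -> : partial_sum xi [::] = cst 0.
    by apply/funext => w; rewrite /partial_sum big_nil.
  rewrite preimage_cst; case: ifP => _.
    by rewrite setTI probability_setT mul1e.
  by rewrite set0I measure0 mul0e.
case/andP=> xs us xsJ mA mB.
have mC : measurable (cylinder xi J A) by exact: measurable_cylinder.
have addx w : partial_sum xi (x :: s) w = xi x w + partial_sum xi s w.
  by rewrite /partial_sum big_cons.
pose D := (fun p : R * R => p.1 + p.2) @^-1` B.
have mD : measurable D.
  rewrite -[D]setTI; apply: (_ : measurable_fun setT _) => //.
  exact: measurable_funD.
(* Stated for every [J'] since it is used twice: at [J], and at the empty set,
   where it identifies the law of the longer sum. *)
have law J' (E : 'I_n -> set R) : (forall i, measurable (E i)) ->
    (forall i, i \in x :: s -> i \notin J') ->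
    (P (partial_sum xi (x :: s) @^-1` B `&` cylinder xi J' E) =
     (distribution P (xi x) \x distribution P (partial_sum xi s)) D *
     P (cylinder xi J' E))%E.
  move=> mE xsJ'.
  have xJ' : x \notin J' by apply: xsJ'; exact: mem_head.
  rewrite -joint_law //; last 2 first.
  - exact: measurable_cylinder.
  - move=> F G mF mG.
    pose E' i := if i == x then F else E i.
    have mE' i : measurable (E' i) by rewrite /E'; case: ifP.
    have cylE : xi x @^-1` F `&` cylinder xi J' E = cylinder xi (x |: J') E'.
      apply/seteqP; split=> w /=.
        move=> [Fw Ew] i /setU1P[->|iJ]; rewrite /E' ?eqxx //.
        by case: eqP => [->//|_]; exact: Ew.
      move=> Ew; split; first by have := Ew x (setU11 _ _); rewrite /E' eqxx.
      move=> i iJ; have := Ew i (setU1r _ iJ).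
      by rewrite /E'; case: eqP => // ix; rewrite -ix iJ in xJ'.
    have -> : xi x @^-1` F `&` partial_sum xi s @^-1` G `&` cylinder xi J' E =
        partial_sum xi s @^-1` G `&` cylinder xi (x |: J') E'.
      by rewrite -cylE setIA (setIC (xi x @^-1` F)).
    rewrite IH //; last first.
      move=> i si; rewrite in_setU1 negb_or xsJ' ?inE ?si ?orbT // andbT.
      by apply: contraNneq xs => <-.
    rewrite !indep // big_setU1 //= {1}/E' eqxx.
    rewrite (eq_bigr (fun i => P (xi i @^-1` E i))); last first.
      by move=> i iJ; rewrite /E'; case: eqP => // ix; rewrite -ix iJ in xJ'.
    by rewrite muleCA muleA.
  congr (P (_ `&` _)); apply/seteqP; split=> w; rewrite /D /=; by rewrite addx.
rewrite law //; congr (_ * _)%E.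
have := law finset.set0 (fun=> setT); rewrite /cylinder.
have -> : [set w | forall i, i \in finset.set0 -> [set: R] (xi i w)] = setT.
  by apply/seteqP; split=> w //= _ i; rewrite inE.
rewrite probability_setT mule1 setIT => -> // i _; by rewrite inE.
Qed.
Lemma mmt_gen_partial_sum (sigma : R) xi s (r : R) :
  0 < sigma -> isotropic_gaussian sigma xi -> uniq s ->
  'M_P (partial_sum xi s) r =
  (expR (r ^+ 2 * ((size s)%:R * sigma ^+ 2) / 2))%:E.
Proof.
move=> sigma0 [indep law]; elim: s => [_|x s IH /= /andP[xs us]].
  rewrite /mmt_gen_fun unlock mul0r mulr0 mul0r expR0.
  rewrite (eq_integral (cst 1%E)).
    by rewrite integral_cst // mul1e; exact: (@probability_setT _ _ _ P).
  by move=> w _; rewrite /partial_sum /= big_nil mul0r expR0.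
have -> : partial_sum xi (x :: s) = xi x \+ partial_sum xi s.
  by apply/funext => w; rewrite /partial_sum big_cons.
rewrite mmt_gen_indepD.
  rewrite IH // (mmt_gen_normal sigma0) //; last exact: law.
  by rewrite -EFinM -expRD -natr1; congr (expR _)%:E; field.
move=> A B mA mB.
have cyl1 : cylinder xi (finset.set1 x) (fun=> A) = xi x @^-1` A.
  apply/seteqP; split=> w /=; first by apply; rewrite inE.
  by move=> Aw i; rewrite inE => /eqP ->.
have xsJ i : i \in s -> i \notin finset.set1 x.
  by move=> si; rewrite inE; apply: contraNneq xs => <-.
have := partial_sum_indep indep us xsJ (A := fun=> A) (fun=> mA) mB.
by rewrite cyl1 setIC => ->; rewrite muleC.
Qed.

Lemma measurable_partial_sum_gt xi s (a : R) :
  measurable [set w | a < `|partial_sum xi s w|].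
Proof.
have ma : measurable_fun setT (fun w => a < `|partial_sum xi s w|).
  by apply: measurable_fun_ltr => //; exact: measurableT_comp.
by have := ma measurableT [set true] I; rewrite setTI.
Qed.

Lemma gaussian_sum_tail (sigma : R) xi s (a : R) :
  0 < sigma -> isotropic_gaussian sigma xi -> uniq s -> (0 < size s)%N ->
  0 < a ->
  (P [set w | (a < `|partial_sum xi s w|)%R] <=
   (2 * expR (- (a ^+ 2 / (2 * ((size s)%:R * sigma ^+ 2)))))%:E)%E.
Proof.
move=> sigma0 hxi us s0 a0.
set v := (size s)%:R * sigma ^+ 2.
have v0 : 0 < v by rewrite mulr_gt0 ?ltr0n ?exprn_gt0.
(* The value of [r] minimizing the Chernoff exponent [r ^+ 2 * v / 2 - r * a]. *)
pose r := a / v; have r0 : 0 < r by rewrite divr_gt0.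
pose X : {RV P >-> R} := partial_sum xi s.
pose Y : {RV P >-> R} := (- X)%R.
have bound (Z : {RV P >-> R}) : 'M_P Z r = (expR (r ^+ 2 * v / 2))%:E ->
    (P [set w | (Z w >= a)%R] <= (expR (- (a ^+ 2 / (2 * v))))%:E)%E.
  move=> MZ; rewrite (le_trans (chernoff Z a r0)) // MZ -EFinM -expRD lee_fin.
  by rewrite ler_expR le_eqVlt /r; apply/orP; left; apply/eqP; field; rewrite gt_eqF.
have bX : 'M_P X r = (expR (r ^+ 2 * v / 2))%:E.
  exact: (mmt_gen_partial_sum r sigma0 hxi us).
have bY : 'M_P Y r = (expR (r ^+ 2 * v / 2))%:E.
  rewrite -[r ^+ 2]sqrrN -(mmt_gen_partial_sum (- r) sigma0 hxi us) /mmt_gen_fun.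
  by congr expectation; apply/funext => w /=; rewrite mulrN mulNr.
have mge (Z : {RV P >-> R}) : measurable [set w | (Z w >= a)%R].
  rewrite -[X in measurable X]setTI; exact: measurable_fun_le.
apply: (@le_trans _ _ (P ([set w | (X w >= a)%R] `|` [set w | (Y w >= a)%R]))).
  apply: le_measure; rewrite ?inE.
  - exact: measurable_partial_sum_gt.
  - by apply: measurableU.
  - move=> w /=; rewrite lter_normr => /orP[/ltW|/ltW]; by [left|right].
rewrite (le_trans (measureU2 _ _ _)) // mulr_natl mulr2n EFinD.
by apply: leeD; apply: bound.
Qed.
End IndependentSums.

(** * Uniform control of the noise over intervals *)

Lemma card_ord_itv (n a b : nat) : (b <= n)%N ->
  size [seq j : 'I_n <- enum 'I_n | (a <= j < b)%N] = (b - a)%N.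
Proof.
move=> bn; rewrite size_filter -sum1_count big_enum_cond /=.
rewrite -(big_mkord (fun j => a <= j < b)%N (fun=> 1%N)).
transitivity (\sum_(a <= j < b) 1)%N; last by rewrite sum_nat_const_nat muln1.
rewrite [RHS](big_nat_widen _ _ n) // (big_nat_widenl a 0) //.
by apply: eq_bigl => j /=; rewrite andbC.
Qed.

Lemma union_bound (R : realType) (d : measure_display)
    (Omega : measurableType d) (P : probability Omega R) (I : finType)
    (B : I -> set Omega) (c : R) :
  (forall i, measurable (B i)) -> (forall i, (P (B i) <= c%:E)%E) ->
  measurable (\big[setU/set0]_i B i) /\
  (P (\big[setU/set0]_i B i) <= (c *+ #|I|)%:E)%E.
Proof.
move=> mB PB; have -> : #|I| = size (index_enum I) by rewrite cardT enumT.
elim: (index_enum I) => [|i s [mU PU]].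
  by rewrite big_nil mulr0n measure0; split.
rewrite big_cons /= mulrS EFinD; split; first exact: measurableU.
by apply: (le_trans (measureU2 _ _ _)) => //; apply: leeD; [exact: PB|exact: PU].
Qed.

(** At the threshold below the Gaussian tail of every normalized interval sum is
[2 * (delta / n) ^+ 2], and there are at most [n ^ 2] intervals. *)
Lemma interval_sums_event (R : realType) (d : measure_display)
    (Omega : measurableType d) (P : probability Omega R) (n : nat)
    (sigma delta : R) (xi : 'I_n -> {RV P >-> R}) :
  (0 < n)%N -> 0 < sigma -> 0 < delta < 1 -> isotropic_gaussian sigma xi ->
  exists E : set Omega,
    [/\ measurable E, ((1 - 2 * delta)%:E <= P E)%E &
      forall w, E w -> forall a b : nat, (a <= b <= n)%N ->
        `|\sum_(j < n | (a <= j < b)%N) xi j w| <=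
        2 * sigma * Num.sqrt (ln (n%:R / delta)) * Num.sqrt (b - a)%:R].
Proof.
move=> n0 sigma0 /andP[delta0 delta1] hxi.
set L := ln (n%:R / delta).
have n0' : 0 < n%:R :> R by rewrite ltr0n.
have nd : 1 < n%:R / delta.
  by rewrite ltr_pdivlMr // mul1r (lt_le_trans delta1) // ler1n.
have L0 : 0 < L by rewrite ln_gt0.
pose s a b := [seq j : 'I_n <- enum 'I_n | (a <= j < b)%N].
pose thr m := 2 * sigma * Num.sqrt L * Num.sqrt (m%:R : R).
(* The pair [p] stands for the closed interval from [p.1] to [p.2]; with
   closed intervals the index set has [n ^ 2] elements, not [(n + 1) ^ 2]. *)
pose B (p : 'I_n * 'I_n) : set Omega :=
  if (p.1 <= p.2)%N then
    [set w | thr (p.2.+1 - p.1)%N < `|partial_sum xi (s p.1 p.2.+1) w|]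
  else set0.
have mB p : measurable (B p).
  by rewrite /B; case: ifP => _; [exact: measurable_partial_sum_gt|].
have PB p : (P (B p) <= (2 * (delta / n%:R) ^+ 2)%:E)%E.
  rewrite /B; case: ifP => [p12|_]; last first.
    by rewrite measure0 lee_fin mulr_ge0 // sqr_ge0.
  have sz : size (s p.1 p.2.+1) = (p.2.+1 - p.1)%N by rewrite card_ord_itv.
  set m := (p.2.+1 - p.1)%N in sz *.
  have m0 : (0 < m)%N by rewrite subn_gt0 ltnS.
  have m0' : 0 < m%:R :> R by rewrite ltr0n.
  apply: (le_trans (gaussian_sum_tail sigma0 hxi _ _ _)).
  - by rewrite filter_uniq // enum_uniq.
  - by rewrite sz.
  - by rewrite !mulr_gt0 // sqrtr_gt0.
  rewrite lee_fin ler_pM2l // sz /thr.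
  have -> : (2 * sigma * Num.sqrt L * Num.sqrt m%:R) ^+ 2 /
      (2 * (m%:R * sigma ^+ 2)) = L + L.
    rewrite !exprMn !sqr_sqrtr ?ltW //; field.
    by rewrite !gt_eqF.
  rewrite opprD expRD expRN lnK; last by rewrite posrE (lt_trans _ nd).
  by rewrite invf_div -expr2.
have [mU PU] := union_bound mB PB.
exists (~` \big[setU/set0]_p B p); split.
- exact: measurableC.
- rewrite probability_setC // EFinB leeB // (le_trans PU) // lee_fin.
  rewrite card_prod card_ord -[X in X <= _]mulr_natr natrM.
  have -> : 2 * (delta / n%:R) ^+ 2 * (n%:R * n%:R) = 2 * (delta * delta) :> R.
    by field; rewrite gt_eqF.
  by rewrite ler_pM2l // ler_piMr ?ltW.
move=> w Ew a b /andP[ab bn].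
case: (ltngtP a b) ab => // [ab _|-> _]; last first.
  rewrite big_pred0; last by move=> j; rewrite ltnNge andbN.
  by rewrite normr0 !mulr_ge0 ?sqrtr_ge0 // ltW.
case: b ab bn => // b ab bn.
rewrite leNgt; apply/negP => bad; apply: Ew.
rewrite -bigcup_seq.
exists (Ordinal (leq_ltn_trans (ab : (a <= b)%N) bn), Ordinal bn) => /=.
  by rewrite mem_index_enum.
rewrite /B /= -ltnS ab /= /partial_sum big_filter big_enum_cond //.
Qed.

(** * The bump profile *)

Section Bump.
Variables (R : realType).

Lemma sqr_sqrt_increment_le (k : nat) :
  (Num.sqrt k.+1%:R - Num.sqrt k%:R) ^+ 2 <= (k.+1%:R : R)^-1.
Proof.
set a := Num.sqrt k.+1%:R; set b := Num.sqrt k%:R.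
have ea : a ^+ 2 = k.+1%:R by rewrite sqr_sqrtr.
have eb : b ^+ 2 = k%:R by rewrite sqr_sqrtr.
have a0 : 0 < a by rewrite sqrtr_gt0.
have b0 : 0 <= b by rewrite sqrtr_ge0.
have ba : b <= a by rewrite ler_wsqrtr // ler_nat.
have e1 : (a - b) * (a + b) = 1 by rewrite -subr_sqr ea eb -natr1 addrC addKr.
have le1 : (a - b) * a <= 1 by rewrite -e1 ler_wpM2l ?subr_ge0 // lerDl.
rewrite -ea -exprVn ler_sqr ?nnegrE ?subr_ge0 ?invr_ge0 //; last exact: ltW.
by rewrite -[a^-1]mul1r ler_pdivlMr.
Qed.

Lemma harmonic_le (n : nat) : (0 < n)%N ->
  \sum_(k < n) (k.+1%:R : R)^-1 <= 1 + ln n%:R.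
Proof.
case: n => // n _; elim: n => [|n IH].
  by rewrite big_ord1 invr1 ln1 addr0.
rewrite big_ord_recr /=; apply: (le_trans (lerD IH (lexx _))).
rewrite -addrA lerD2l.
have n1 : 0 < n.+1%:R :> R by [].
have n2 : 0 < n.+2%:R :> R by [].
have := @le_ln1Dx R (- n.+2%:R^-1).
have -> : 1 + - n.+2%:R^-1 = n.+1%:R / n.+2%:R :> R.
  rewrite -[n.+2%:R]natr1; set m : R := n.+1%:R in n1 *.
  by field; rewrite gt_eqF //; lra.
rewrite ln_div ?posrE // ltrN2 => H.
move: H; rewrite invf_lt1 // ltr1n => /(_ isT).
by move: (ln _) (ln _) (_^-1) => a b c; lra.
Qed.

Variables (n D : nat).
Hypotheses (n0 : (0 < n)%N) (D0 : (0 < D)%N).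

(** Before it is cut off at 0, the profile has a square-root term, on the scale
[n] of the noise, and a linear term, on the scale [D] of the spacing. *)
Definition ramp (k : nat) : R :=
  1 - 5 / 2 * (Num.sqrt k%:R / Num.sqrt n%:R) - 2 * k%:R / D%:R.

Definition bump (k : nat) : R := Num.max 0 (ramp k).

Let sn0 : 0 < Num.sqrt n%:R :> R. Proof. by rewrite sqrtr_gt0 ltr0n. Qed.
Let D0' : 0 < D%:R :> R. Proof. by rewrite ltr0n. Qed.

Lemma bump0 : bump 0 = 1.
Proof.
by rewrite /bump /ramp sqrtr0 mul0r !mulr0 mul0r !subr0 max_r.
Qed.

Lemma bump_ge0 k : 0 <= bump k.
Proof. by rewrite /bump le_max lexx. Qed.

Lemma bump_eq0 k : (D <= 2 * k)%N -> bump k = 0.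
Proof.
move=> Dk; rewrite /bump max_l // /ramp.
have : 1 <= 2 * k%:R / D%:R :> R.
  by rewrite ler_pdivlMr // mul1r -natrM ler_nat.
have : 0 <= Num.sqrt k%:R / Num.sqrt n%:R :> R by rewrite divr_ge0 ?sqrtr_ge0.
lra.
Qed.

Lemma ramp_drop k : ramp k - ramp k.+1 =
  5 / 2 * ((Num.sqrt k.+1%:R - Num.sqrt k%:R) / Num.sqrt n%:R) + 2 / D%:R.
Proof. by rewrite /ramp -natr1; field; rewrite !gt_eqF. Qed.

Lemma ramp_drop_ge0 k : 0 <= ramp k - ramp k.+1.
Proof.
rewrite ramp_drop addr_ge0 ?divr_ge0 ?(ltW D0') // mulr_ge0 //.
by rewrite divr_ge0 ?(ltW sn0) // subr_ge0 ler_wsqrtr // ler_nat.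
Qed.

Lemma bump_drop k : 0 <= bump k - bump k.+1 <= ramp k - ramp k.+1.
Proof.
have := ramp_drop_ge0 k; rewrite /bump.
by case: (leP 0 (ramp k)); case: (leP 0 (ramp k.+1)); lra.
Qed.

Lemma bump_le1 k : bump k <= 1.
Proof.
elim: k => [|k IH]; first by rewrite bump0.
by have /andP[h _] := bump_drop k; apply: le_trans IH; rewrite -subr_ge0.
Qed.

(** The left-hand side is the fluctuation of the noise over distance [k], damped by
the bump, in units of [tau]; the right-hand side is the part [1 - bump k] of the room
between the largest tail sum, [sqrt n], and the penalty, [sqrt (2 n)].
The slope [5 / 2] of the square root works because
[5 / 2 * (sqrt 2 - 1) >= 1]. *)
Lemma bump_sqrt_le k :
  bump k * Num.sqrt k%:R <=
  (1 - bump k) * ((Num.sqrt 2 - 1) * Num.sqrt n%:R).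
Proof.
have s2 : 7 / 5 <= Num.sqrt 2 :> R.
  rewrite -(@ler_sqr R) ?nnegrE ?sqrtr_ge0 // ?sqr_sqrtr //; lra.
have k0 : 0 <= Num.sqrt k%:R :> R by rewrite sqrtr_ge0.
have b1 := bump_le1 k; have b0 := bump_ge0 k.
have [r0|r0] := leP (ramp k) 0.
  rewrite {1}/bump max_l // mul0r mulr_ge0 ?subr_ge0 // mulr_ge0 ?(ltW sn0) //; lra.
have bE : bump k = ramp k by rewrite /bump max_r // ltW.
apply: (@le_trans _ _ (Num.sqrt k%:R)); first by rewrite ler_piMl.
apply: (@le_trans _ _ (5 / 2 * (Num.sqrt k%:R / Num.sqrt n%:R) *
    (2 / 5 * Num.sqrt n%:R))).
  rewrite le_eqVlt; apply/orP; left; apply/eqP; field; by rewrite gt_eqF.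
apply: ler_pM.
- by rewrite mulr_ge0 // divr_ge0 // ltW.
- by rewrite mulr_ge0 // ltW.
- rewrite bE /ramp.
  have : 0 <= 2 * k%:R / D%:R :> R by rewrite divr_ge0 // ltW.
  lra.
- by rewrite ler_pM2r //; lra.
Qed.

(** A drop [x] of the bump is at most [a + b], with [a] from the square root and
[b = 2 / D], so [x ^+ 2 <= x * a + x * b] and therefore
[x ^+ 2 <= a ^+ 2 + 2 * b * x]. The drops [x] sum to at most 1, which makes the
linear term cost [4 / D] instead of a multiple of its number of steps over
[D ^+ 2]; the squares of [a] form a harmonic sum. *)
Lemma bump_energy m : (m <= n)%N ->
  \sum_(k < m) (bump k - bump k.+1) ^+ 2 <=
  4 / D%:R + 25 / 4 * ((1 + ln n%:R) / n%:R).
Proof.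
move=> mn.
pose x k := bump k - bump k.+1.
pose a k : R := 5 / 2 * ((Num.sqrt k.+1%:R - Num.sqrt k%:R) / Num.sqrt n%:R).
have step k : x k ^+ 2 <= 4 / D%:R * x k + 25 / 4 * (n%:R^-1 * k.+1%:R^-1).
  have /andP[x0 xr] := bump_drop k; rewrite ramp_drop -/(a k) -/(x k) in x0 xr.
  have aE : a k ^+ 2 <= 25 / 4 * (n%:R^-1 * k.+1%:R^-1).
    rewrite /a !exprMn !exprVn [Num.sqrt n%:R ^+ 2]sqr_sqrtr ?ler0n //.
    rewrite [X in _ <= _ * X]mulrC.
    have -> : (5 : R) ^+ 2 * (2 ^+ 2)^-1 = 25 / 4 by field.
    rewrite ler_pM2l; last by lra.
    by rewrite ler_wpM2r ?invr_ge0 ?ler0n // sqr_sqrt_increment_le.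
  apply: le_trans (lerD (lexx _) aE).
  have e : 4 / D%:R * x k = 2 * (2 / D%:R * x k) by field; rewrite gt_eqF.
  have := sqr_ge0 (x k - a k); have := ler_wpM2l x0 xr.
  rewrite e sqrrB; nra.
apply: (@le_trans _ _ (\sum_(k < m)
    (4 / D%:R * x k + 25 / 4 * (n%:R^-1 * k.+1%:R^-1)))).
  by apply: ler_sum => k _; exact: step.
rewrite big_split /= -!mulr_sumr; apply: lerD.
  rewrite ler_piMr ?divr_ge0 ?(ltW D0') //.
  rewrite -(big_mkord xpredT x) /x.
  rewrite (telescope_sumr_eq (fun k => - bump k)) //; last first.
    by move=> k _; rewrite opprK addrC.
  by rewrite opprK bump0 addrC gerBl bump_ge0.
rewrite ler_pM2l; last by lra.
rewrite mulrC ler_wpM2r ?invr_ge0 ?ler0n //.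
apply: le_trans (harmonic_le n0).
rewrite -!(big_mkord xpredT (fun k => (k.+1%:R : R)^-1)).
by rewrite [X in _ <= X](big_cat_nat (n := m)) //= lerDl sumr_ge0.
Qed.
End Bump.

(** * Spacing of the jump set *)

Section Spacing.
Variables (n : nat) (T : {set 'I_n}).

(** The gap between [a] and [b] contains the gap between [a] and the next knot. *)
Lemma min_spacing_le_gap (a b : 'I_n.+1) :
  a \in knots T -> b \in knots T -> (a < b)%N -> (min_spacing T <= b - a)%N.
Proof.
move=> aK bK ab.
pose Q (c : 'I_n.+1) := (c \in knots T) && (a < c)%N.
have Qb : Q b by rewrite /Q bK.
have [c /andP[cK ac] cmin] := arg_minnP (fun c : 'I_n.+1 => c : nat) Qb.
have consec : consecutive (knots T) a c.
  rewrite /consecutive aK cK ac /=; apply/forallP => e; apply/implyP => eK.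
  apply/negP => /andP[ae ec].
  by have := cmin e; rewrite /Q eK ae => /(_ isT); rewrite leqNgt ec.
apply: (@leq_trans (c - a)); last by apply: leq_sub2r; exact: cmin.
rewrite /min_spacing; have := mem_index_enum (a, c).
elim: (index_enum _) => // p s IH; rewrite in_cons big_cons => /orP[/eqP <-|/IH le].
  by rewrite consec geq_minl.
by case: ifP => // _; rewrite geq_min le orbT.
Qed.

Lemma min_spacing_gt0 : (0 < n)%N -> (0 < min_spacing T)%N.
Proof.
move=> n0; rewrite /min_spacing; elim/big_ind: _ => //.
  by move=> a b a0 b0; rewrite leq_min a0.
by move=> [a b] /and4P[_ _ ab _]; rewrite subn_gt0.
Qed.

Lemma min_spacing_le : (min_spacing T <= n)%N.
Proof.
rewrite /min_spacing; elim/big_ind: _ => //.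
  by move=> a b an bn; rewrite geq_min an.
by move=> [a b] _ /=; rewrite (leq_trans (leq_subr _ _)) // -ltnS.
Qed.

Lemma mem_knots (t : 'I_n) : t \in T -> widen_ord (leqnSn n) t \in knots T.
Proof.
move=> tT; rewrite /knots !in_setU1; apply/orP; right; apply/orP; right.
exact: imset_f.
Qed.

Lemma min_spacing_le_dist (s t : 'I_n) :
  s \in T -> t \in T -> (s < t)%N -> (min_spacing T <= t - s)%N.
Proof. by move=> /mem_knots sK /mem_knots tK /(min_spacing_le_gap sK tK). Qed.

(** The end point [n] is a knot, so that a bump around a point of [T] has died out
before the end. *)
Lemma min_spacing_le_end (t : 'I_n) : t \in T -> (min_spacing T <= n - t)%N.
Proof.
move=> /mem_knots tK; apply: (min_spacing_le_gap tK (b := ord_max)) => /=.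
  by rewrite /knots !in_setU1 eqxx orbT.
exact: ltn_ord.
Qed.
End Spacing.

(** * Summation by parts and duality *)

Section SummationByParts.
Variables (R : realType) (n : nat).
Implicit Types (u : 'rV[R]_n) (q : nat -> R).

(** There is no boundary term at the start because the value before the first
coordinate is 0; [q n = 0] removes the one at the end. *)
Lemma sum_mul_jump u q : q n = 0 ->
  \sum_(i < n) q i * jump u i = \sum_(i < n) (q i - q i.+1) * u 0 i.
Proof.
case: n u => [|m] u qn; first by rewrite !big_ord0.
pose U k := u 0 (inord k : 'I_m.+1).
pose prev k := if k == 0%N then 0 else U k.-1.
have jumpE (i : 'I_m.+1) : jump u i = U i - prev i.
  rewrite /jump /U /prev inord_val; congr (_ - _); case: eqP => // /eqP i0.
  congr (u 0 _); apply: val_inj; rewrite /= inordK.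
    case: i i0 => -[//|i] /= im _.
    by rewrite modnDr modn_small // ltnW.
  by rewrite (leq_ltn_trans (leq_pred _)).
have parts k : \sum_(i < k) q i * (U i - prev i) =
    \sum_(i < k) (q i - q i.+1) * U i + q k * prev k.
  elim: k => [|k IH]; first by rewrite !big_ord0 /prev mulr0 addr0.
  by rewrite !big_ord_recr /= IH /prev /=; ring.
transitivity (\sum_(i < m.+1) q i * (U i - prev i)).
  by apply: eq_bigr => i _; rewrite jumpE.
rewrite parts qn mul0r addr0.
by apply: eq_bigr => i _; rewrite /U inord_val.
Qed.

Definition tail_sum (x : 'I_n -> R) (a : nat) : R := \sum_(j < n | (a <= j)%N) x j.

Lemma tail_sum_end x : tail_sum x n = 0.
Proof. by rewrite /tail_sum big_pred0 // => j; rewrite leqNgt ltn_ord. Qed.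

Lemma tail_sumB x a b : (a <= b)%N ->
  tail_sum x a - tail_sum x b = \sum_(j < n | (a <= j < b)%N) x j.
Proof.
move=> ab; rewrite /tail_sum (bigID (fun j : 'I_n => (j < b)%N)) /= -addrA.
rewrite (_ : \sum_(j < n | (a <= j)%N && ~~ (j < b)%N) x j = tail_sum x b).
  by rewrite subrr addr0.
apply: eq_bigl => j; rewrite -leqNgt; case: (leqP b j) => bj; rewrite ?andbF //.
by rewrite (leq_trans ab).
Qed.

Lemma sum_mul_tail_sum x u :
  \sum_(i < n) x i * u 0 i = \sum_(i < n) tail_sum x i * jump u i.
Proof.
rewrite (sum_mul_jump u (tail_sum_end x)); apply: eq_bigr => i _; congr (_ * _).
rewrite tail_sumB // (big_pred1 i) // => j.
by rewrite ltnS -eqn_leq eq_sym.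
Qed.

Lemma tv_onB (T : {set 'I_n}) u :
  tv_on T u - tv_on (~: T) u =
  \sum_(i < n) (if i \in T then `|jump u i| else - `|jump u i|).
Proof.
rewrite (bigID (fun i => i \in T)) /=; congr (_ + _).
  by apply: eq_bigr => i ->.
by rewrite /tv_on -sumrN; apply: eq_big => [i|i]; rewrite !inE // => /negbTE ->.
Qed.

(** By the hypothesis on [q] the noise and the penalty together are at most twice
the pairing of [q] with the jumps, hence of the increments of [q] with [u], and
[2 * a * b - b ^+ 2 <= a ^+ 2]. *)
Lemma dual_certificate (x : 'I_n -> R) u q (K : R) (T : {set 'I_n}) :
  q n = 0 ->
  (forall i : 'I_n, (tail_sum x i - q i) * jump u i +
     K * (if i \in T then `|jump u i| else - `|jump u i|) <= 0) ->
  2 * (\sum_(i < n) x i * u 0 i) + 2 * K * (tv_on T u - tv_on (~: T) u)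
    - sqnorm2 u <= \sum_(i < n) (q i - q i.+1) ^+ 2.
Proof.
move=> qn cert; rewrite sum_mul_tail_sum tv_onB -mulrA -mulrDr mulr_sumr -big_split /=.
rewrite lerBlDr; apply: (@le_trans _ _ (2 * \sum_(i < n) q i * jump u i)).
  rewrite ler_pM2l //; apply: ler_sum => i _.
  by have := cert i; rewrite mulrBl addrAC subr_le0.
rewrite (sum_mul_jump u qn) /sqnorm2 -big_split /= mulr_sumr.
apply: ler_sum => i _; have := sqr_ge0 (q i - q i.+1 - u 0 i).
by rewrite sqrrB -mulr_natl; lra.
Qed.
End SummationByParts.

(** * The dual certificate *)

Lemma sqr_sum_orthogonal (R : realType) (I : finType) (Q : pred I) (a : I -> R) :
  (forall i j, Q i -> Q j -> i != j -> a i * a j = 0) ->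
  (\sum_(i | Q i) a i) ^+ 2 = \sum_(i | Q i) a i ^+ 2.
Proof.
move=> orth; rewrite expr2 mulr_suml; apply: eq_bigr => i Qi.
rewrite mulr_sumr (bigD1 i) //= big1 ?addr0 // => j /andP[Qj ji].
by apply: orth => //; rewrite eq_sym.
Qed.

Lemma sqrrD_le2 (R : realType) (a b : R) : (a + b) ^+ 2 <= 2 * a ^+ 2 + 2 * b ^+ 2.
Proof. by have := sqr_ge0 (a - b); nra. Qed.

(** The certificate [q] and the properties of it that [dual_certificate] asks for,
for a noise vector [x] in the event on interval sums. *)
Section Certificate.
Variables (R : realType) (n : nat) (x : 'I_n -> R) (u : 'rV[R]_n)
  (T : {set 'I_n}) (tau : R).
Hypotheses (n0 : (0 < n)%N) (tau0 : 0 <= tau).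
Hypothesis noise : forall a b : nat, (a <= b <= n)%N ->
  `|\sum_(j < n | (a <= j < b)%N) x j| <= tau * Num.sqrt (b - a)%:R.

Let D := min_spacing T.
Let D0 : (0 < D)%N. Proof. exact: min_spacing_gt0. Qed.
Let psi := bump R n D.
Let K := tau * (Num.sqrt 2 * Num.sqrt n%:R).
Let S := tail_sum x.
Let dist (i j : nat) := (i - j + (j - i))%N.
Let A (t : 'I_n) := S t + K * Num.sg (jump u t).
Let q (i : nat) := \sum_(t in T) A t * psi (dist i t).

Let K0 : 0 <= K. Proof. by rewrite !mulr_ge0 ?sqrtr_ge0. Qed.

Let psi_far k : (D <= 2 * k)%N -> psi k = 0.
Proof. exact: bump_eq0. Qed.

Let spaced (s t : 'I_n) : s \in T -> t \in T -> s != t -> (D <= dist s t)%N.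
Proof.
move=> sT tT st; rewrite /dist; case: (ltngtP s t) => [lt|lt|/val_inj e].
- by rewrite (leq_trans (min_spacing_le_dist sT tT lt)) // leq_addl.
- by rewrite (leq_trans (min_spacing_le_dist tT sT lt)) // leq_addr.
- by rewrite e eqxx in st.
Qed.

Let tail_dist a b : (a <= n)%N -> (b <= n)%N ->
  `|S a - S b| <= tau * Num.sqrt (dist a b)%:R.
Proof.
wlog ab : a b / (a <= b)%N => [hw an bn|an bn].
  case: (leqP a b) => [/hw|/ltnW /hw]; first exact.
  by rewrite distrC /dist addnC; exact.
rewrite /S tail_sumB // /dist (eqP ab) add0n; apply: noise.
by rewrite ab.
Qed.

Let tail_le a : (a <= n)%N -> `|S a| <= tau * Num.sqrt n%:R.
Proof.
move=> an; rewrite -[S a]subr0 -(tail_sum_end x).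
apply: (le_trans (tail_dist an (leqnn n))); rewrite ler_wpM2l // ler_wsqrtr //.
by rewrite ler_nat /dist (eqP an) add0n leq_subr.
Qed.

Let q_far (i : nat) : (forall t, t \in T -> (D <= 2 * dist i t)%N) -> q i = 0.
Proof.
by move=> far; rewrite /q big1 // => t tT; rewrite psi_far ?mulr0 //; exact: far.
Qed.

(** At most one bump is positive at a given index, since two points of [T] within
less than [D / 2] of it would be closer to each other than [D]. *)
Let q_near (i : nat) t : t \in T -> (2 * dist i t < D)%N -> q i = A t * psi (dist i t).
Proof.
move=> tT near; rewrite /q (bigD1 t) //= big1 ?addr0 // => s /andP[sT st].
rewrite psi_far ?mulr0 //; have := spaced sT tT st; move: near.
by rewrite /dist; lia.
Qed.

Let q_end : q n = 0.
Proof.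
by apply: q_far => t tT; have := min_spacing_le_end tT; rewrite /dist -/D; lia.
Qed.

(** On [T] the value of [q] is exact and the two terms cancel. Off [T], where [q]
is [f] times the height at the nearest [t],
[S i - q i = f * (S i - S t) + (1 - f) * S i - f * K * sg], and the three terms
add up to at most [K] by [bump_sqrt_le]. *)
Let q_cert (i : 'I_n) : (S i - q i) * jump u i +
  K * (if i \in T then `|jump u i| else - `|jump u i|) <= 0.
Proof.
have [iT|iT] := boolP (i \in T).
  have -> : q i = A i.
    by rewrite (q_near iT) /dist subnn ?muln0 // /psi bump0 // mulr1.
  rewrite /A opprD addrA subrr sub0r mulNr -mulrA.
  by rewrite -normrEsg addNr.
rewrite mulrN subr_le0; apply: (le_trans (ler_norm _)).
rewrite normrM ler_wpM2r //.
have Si : `|S i| <= tau * Num.sqrt n%:R by apply: tail_le; exact: ltnW.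
have s2 : 1 <= Num.sqrt 2 :> R by rewrite -[leLHS]sqrtr1 ler_wsqrtr // ler1n.
have [/existsP[t /andP[tT near]]|far] :=
  boolP [exists t, (t \in T) && (2 * dist i t < D)%N]; last first.
  rewrite q_far ?subr0; last first.
    move=> t tT; rewrite leqNgt; apply/negP => near; move/existsP: far; apply.
    by exists t; rewrite tT.
  apply: (le_trans Si); rewrite /K ler_wpM2l // ler_peMl ?sqrtr_ge0 //.
rewrite (q_near tT near); set k := dist i t; set f := psi k.
have f0 : 0 <= f by exact: bump_ge0.
have f1 : f <= 1 by exact: bump_le1.
have fk : f * Num.sqrt k%:R <= (1 - f) * ((Num.sqrt 2 - 1) * Num.sqrt n%:R).
  exact: bump_sqrt_le.
have St : `|S i - S t| <= tau * Num.sqrt k%:R by apply: tail_dist; exact: ltnW.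
have -> : S i - A t * f = f * (S i - S t) + (1 - f) * S i - f * K * Num.sg (jump u t).
  by rewrite /A; ring.
have sg1 : `|Num.sg (jump u t)| <= 1 by rewrite normr_sg; case: eqP.
have h1 : `|f * (S i - S t)| <= tau * (f * Num.sqrt k%:R).
  by rewrite normrM ger0_norm // mulrCA ler_wpM2l.
have h2 : `|(1 - f) * S i| <= (1 - f) * (tau * Num.sqrt n%:R).
  by rewrite normrM ger0_norm ?subr_ge0 // ler_wpM2l // subr_ge0.
have h3 : `|f * K * Num.sg (jump u t)| <= f * K.
  by rewrite normrM ger0_norm ?mulr_ge0 // ler_piMr // mulr_ge0.
apply: (le_trans (ler_normB _ _)); apply: (le_trans (lerD (ler_normD _ _) (lexx _))).
apply: (le_trans (lerD (lerD h1 h2) h3)).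
have := ler_wpM2l tau0 fk; rewrite /K; lra.
Qed.

Let drop k := psi k - psi k.+1.

Let drop_far k : (D <= 2 * k)%N -> drop k = 0.
Proof. by move=> Dk; rewrite /drop !psi_far ?subrr //; lia. Qed.

Let energy := \sum_(k < n) drop k ^+ 2.

Let energy_right (t : 'I_n) :
  \sum_(i < n | (t <= i)%N) drop (i - t) ^+ 2 <= energy.
Proof.
rewrite -(big_mkord (fun i => (t <= i)%N) (fun i => drop (i - t) ^+ 2)).
rewrite -(big_nat_widenl t 0 n predT) // -{1}[t : nat]add0n big_addn.
rewrite /energy -(big_mkord xpredT (fun k => drop k ^+ 2)).
rewrite [X in _ <= X](big_cat_nat (n := n - t)) ?leq_subr //=.
under eq_bigr do rewrite addnK.
by rewrite lerDl sumr_ge0 // => k _; exact: sqr_ge0.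
Qed.

Let energy_left (t : 'I_n) :
  \sum_(i < n | (i < t)%N) drop (t - i.+1) ^+ 2 <= energy.
Proof.
have tn : (t <= n)%N by exact: ltnW.
rewrite -(big_mkord (fun i => (i < t)%N) (fun i => drop (t - i.+1) ^+ 2)).
rewrite -(big_nat_widen 0 t n predT) //.
rewrite /energy -(big_mkord xpredT (fun k => drop k ^+ 2)).
rewrite [X in _ <= X](big_cat_nat (n := t)) //=.
rewrite big_nat_rev /= add0n.
rewrite (eq_big_nat _ _ (F2 := fun k => drop k ^+ 2)); last first.
  by move=> k /andP[_ kt]; rewrite -subSn // subSS subKn 1?ltnW.
by rewrite lerDl sumr_ge0 // => k _; exact: sqr_ge0.
Qed.

(** Bumps on the left of the step from [i] to [i.+1] go down and those on the right
go up. On either side at most one term is nonzero, so that the energy of [q]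
splits, up to a factor 2, into the energies of the separate half-bumps. *)
Let q_drop (i : nat) : q i - q i.+1 =
  \sum_(t in T | (t <= i)%N) A t * drop (i - t) +
  \sum_(t in T | (i < t)%N) - (A t * drop (t - i.+1)).
Proof.
rewrite /q -sumrB (bigID (fun t : 'I_n => (t <= i)%N)) /=; congr (_ + _).
  apply: eq_bigr => t /andP[_ ti]; rewrite -mulrBr /drop /dist.
  by congr (_ * (psi _ - psi _)); lia.
apply: eq_big => [t|t]; first by rewrite -ltnNge.
move=> /andP[_ ti]; rewrite -mulrBr -mulrN /drop opprB /dist.
by congr (_ * (psi _ - psi _)); lia.
Qed.

Let A_le t : A t ^+ 2 <= tau ^+ 2 * n%:R * (1 + Num.sqrt 2) ^+ 2.
Proof.
have -> : tau ^+ 2 * n%:R * (1 + Num.sqrt 2) ^+ 2 =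
    (tau * Num.sqrt n%:R + K) ^+ 2.
  rewrite /K; set r := Num.sqrt n%:R.
  have <- : r ^+ 2 = n%:R :> R by rewrite sqr_sqrtr ?ler0n.
  by ring.
rewrite -[A t ^+ 2]real_normK ?num_real // ler_sqr ?nnegrE //; last first.
  by rewrite addr_ge0 // mulr_ge0 ?sqrtr_ge0.
rewrite /A (le_trans (ler_normD _ _)) // lerD //; first by apply: tail_le; exact: ltnW.
by rewrite normrM ger0_norm // ler_piMr // normr_sg; case: eqP.
Qed.

Let q_energy : \sum_(i < n) (q i - q i.+1) ^+ 2 <=
  4 * #|T|%:R * (tau ^+ 2 * n%:R * (1 + Num.sqrt 2) ^+ 2) * energy.
Proof.
pose M := tau ^+ 2 * n%:R * (1 + Num.sqrt 2) ^+ 2.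
have e0 : 0 <= energy by apply: sumr_ge0 => k _; exact: sqr_ge0.
have step (i : 'I_n) : (q i - q i.+1) ^+ 2 <=
    2 * (\sum_(t in T) (if (t <= i)%N then M * drop (i - t) ^+ 2 else 0)) +
    2 * (\sum_(t in T) (if (i < t)%N then M * drop (t - i.+1) ^+ 2 else 0)).
  rewrite q_drop (le_trans (sqrrD_le2 _ _)) //.
  apply: lerD; rewrite ler_pM2l //.
    rewrite sqr_sum_orthogonal -?big_mkcondr.
      by apply: ler_sum => t _; rewrite exprMn ler_wpM2r ?sqr_ge0 ?A_le.
    move=> s t /andP[sT si] /andP[tT ti] st.
    have := spaced sT tT st; have [near|far] := ltnP (2 * (i - s)) D.
      move=> sp; rewrite [drop (i - t)]drop_far ?mulr0 //; move: sp near.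
      by rewrite /dist; lia.
    by rewrite (drop_far far) mulr0 mul0r.
  rewrite sqr_sum_orthogonal -?big_mkcondr.
    by apply: ler_sum => t _; rewrite sqrrN exprMn ler_wpM2r ?sqr_ge0 ?A_le.
  move=> s t /andP[sT si] /andP[tT ti] st.
  have := spaced sT tT st; have [near|far] := ltnP (2 * (s - i.+1)) D.
    move=> sp; rewrite [drop (t - i.+1)]drop_far ?mulr0 ?oppr0 ?mulr0 //; move: sp near.
    by rewrite /dist; lia.
  by rewrite (drop_far far) mulr0 oppr0 mul0r.
apply: (le_trans (ler_sum _ (fun i _ => step i))).
rewrite big_split /= -!mulr_sumr.
rewrite [X in 2 * X + _]exchange_big /= [X in _ + 2 * X]exchange_big /=.
have M0 : 0 <= M by rewrite !mulr_ge0 ?sqr_ge0 ?ler0n.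
have side (F : 'I_n -> 'I_n -> R) : (forall t, \sum_i F i t <= M * energy) ->
    \sum_(t in T) \sum_i F i t <= #|T|%:R * (M * energy).
  move=> FM; rewrite mulr_natl -sumr_const; apply: ler_sum => t _; exact: FM.
have h1 := side (fun i t => if (t <= i)%N then M * drop (i - t) ^+ 2 else 0).
have h2 := side (fun i t => if (i < t)%N then M * drop (t - i.+1) ^+ 2 else 0).
apply: (le_trans (lerD (ler_wpM2l _ (h1 _)) (ler_wpM2l _ (h2 _)))) => //.
- by move=> t; rewrite -big_mkcond -mulr_sumr ler_wpM2l // energy_right.
- by move=> t; rewrite -big_mkcond -mulr_sumr ler_wpM2l // energy_left.
by rewrite /M; lra.
Qed.

Lemma noise_compatibility_bound :
  2 * (\sum_(i < n) x i * u 0 i) + 2 * K * (tv_on T u - tv_on (~: T) u)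
    - sqnorm2 u <=
  4 * #|T|%:R * (tau ^+ 2 * n%:R * (1 + Num.sqrt 2) ^+ 2) *
    (4 / (min_spacing T)%:R + 25 / 4 * ((1 + ln n%:R) / n%:R)).
Proof.
apply: (le_trans (dual_certificate q_end q_cert)); apply: (le_trans q_energy).
apply: ler_wpM2l; first by rewrite !mulr_ge0 ?sqr_ge0 ?ler0n.
exact: bump_energy.
Qed.

End Certificate.

(** * The basic inequality *)

Section BasicInequality.
Variables (R : realType) (n : nat).
Implicit Types (f g h y z : 'rV[R]_n).

Definition dotp f g : R := \sum_(i < n) f 0 i * g 0 i.

Lemma sqnorm2DZ (e : R) f g :
  sqnorm2 (f + e *: g) = sqnorm2 f + 2 * e * dotp f g + e ^+ 2 * sqnorm2 g.
Proof.
rewrite /sqnorm2 /dotp !mulr_sumr -!big_split /=; apply: eq_bigr => i _.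
by rewrite !mxE; ring.
Qed.

Lemma jumpD f g i : jump (f + g) i = jump f i + jump g i.
Proof. by rewrite /jump; case: eqP => _; rewrite !mxE; ring. Qed.

Lemma jumpZ (e : R) f i : jump (e *: f) i = e * jump f i.
Proof. by rewrite /jump; case: eqP => _; rewrite !mxE; ring. Qed.

Lemma tv_convex (e : R) f h : 0 <= e <= 1 ->
  tv (h + e *: (f - h)) <= tv h + e * (tv f - tv h).
Proof.
move=> /andP[e0 e1].
have -> : tv h + e * (tv f - tv h) = (1 - e) * tv h + e * tv f by ring.
rewrite /tv !mulr_sumr -big_split /=; apply: ler_sum => i _.
have -> : h + e *: (f - h) = (1 - e) *: h + e *: f.
  by apply/rowP => j; rewrite !mxE; ring.
rewrite jumpD !jumpZ (le_trans (ler_normD _ _)) // !normrM.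
by rewrite (ger0_norm e0) [`|1 - e|]ger0_norm ?subr_ge0.
Qed.

(** Let [e] tend to 0. In use, [a + e * b] bounds the difference quotient of the
objective along a segment that starts at its minimizer. *)
Lemma small_slope_ge0 (a b : R) :
  (forall e, 0 < e <= 1 -> 0 <= a + e * b) -> 0 <= a.
Proof.
move=> H; rewrite leNgt; apply/negP => a0.
have nb := normr_ge0 b.
have d1 : 0 < - a + (`|b| + 1) by lra.
(* Small enough for [t * `|b| < - a], which contradicts the hypothesis; the 1
   keeps the denominator away from 0 and makes the inequality strict. *)
pose t := - a / (- a + (`|b| + 1)).
have e0 : 0 < t by rewrite divr_gt0 // oppr_gt0.
have e1 : t <= 1 by rewrite ler_pdivrMr // mul1r; lra.
have := H t; rewrite e0 e1 => /(_ isT).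
apply/negP; rewrite -ltNge.
have : t * b <= t * `|b| by rewrite ler_pM2l // ler_norm.
have : t * `|b| < - a.
  rewrite /t mulrAC ltr_pdivrMr // ltr_pM2l ?oppr_gt0 //; lra.
lra.
Qed.

(** First-order optimality, tested along the segment from [h] to [f]. *)
Lemma argmin_variational (lambda : R) y h f : (0 < n)%N -> 0 <= lambda ->
  argmin (tv_objective lambda y) h ->
  0 <= - dotp (y - h) (f - h) + n%:R * lambda * (tv f - tv h).
Proof.
move=> n0 lambda0 hmin.
have N0 : 0 < n%:R :> R by rewrite ltr0n.
apply: (small_slope_ge0 (b := sqnorm2 (f - h) / 2)) => e /andP[e0 e1].
have := hmin (h + e *: (f - h)); rewrite /tv_objective.
have -> : y - (h + e *: (f - h)) = (y - h) + (- e) *: (f - h).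
  by rewrite opprD addrA scaleNr.
rewrite sqnorm2DZ => opt.
have cvx : tv (h + e *: (f - h)) <= tv h + e * (tv f - tv h).
  by apply: tv_convex; rewrite (ltW e0).
have cvx' := ler_wpM2l lambda0 cvx.
have {opt cvx cvx'} opt := le_trans opt (lerD (lexx _) cvx').
have scaled : 0 <= (2 * n%:R)^-1 * (2 * - e * dotp (y - h) (f - h)
    + (- e) ^+ 2 * sqnorm2 (f - h)) + lambda * (e * (tv f - tv h)).
  move: opt; lra.
have c0 : 0 < e / n%:R by rewrite divr_gt0.
rewrite -(pmulr_rge0 _ c0).
apply: le_trans scaled _; rewrite le_eqVlt; apply/orP; left; apply/eqP.
by field; rewrite gt_eqF.
Qed.

(** The cross term of the variational inequality is expanded by the polarization
identity, which is what produces the negative square [- sqnorm2 (h - f)]. *)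
Lemma basic_inequality (lambda : R) fstar (x : 'I_n -> R) h f :
  (0 < n)%N -> 0 <= lambda ->
  argmin (tv_objective lambda (fstar + \row_i x i)) h ->
  sqnorm2 (h - fstar) <= sqnorm2 (f - fstar)
    + 2 * (\sum_(i < n) x i * (h - f) 0 i) + 2 * (n%:R * lambda) * (tv f - tv h)
    - sqnorm2 (h - f).
Proof.
move=> n0 l0 /argmin_variational => /(_ f n0 l0) H.
have -> : sqnorm2 (h - fstar) = sqnorm2 (f - fstar)
    + 2 * (\sum_(i < n) x i * (h - f) 0 i)
    - sqnorm2 (h - f) + 2 * dotp (fstar + \row_i x i - h) (f - h).
  rewrite /sqnorm2 /dotp !mulr_sumr -sumrN -!big_split /=.
  by apply: eq_bigr => i _; rewrite !mxE; ring.
lra.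
Qed.

Lemma tv_difference (T : {set 'I_n}) f h :
  tv f - tv h <= tv_on T (h - f) - tv_on (~: T) (h - f) + 2 * tv_on (~: T) f.
Proof.
have -> : 2 * tv_on (~: T) f = \sum_(i < n) (if i \in T then 0 else 2 * `|jump f i|).
  rewrite /tv_on mulr_sumr big_mkcond /=; apply: eq_bigr => i _.
  by rewrite inE; case: (i \in T).
rewrite tv_onB -big_split /= /tv -sumrB; apply: ler_sum => i _.
have -> : jump (h - f) i = jump h i - jump f i by rewrite -scaleN1r jumpD jumpZ mulN1r.
case: ifP => _.
  by rewrite addr0 [leRHS]distrC lerB_dist.
have := ler_normB (jump h i) (jump f i); lra.
Qed.
End BasicInequality.

(** * The oracle inequality *)

(** Numerically, [4 * (1 + sqrt 2) ^+ 2 <= 24], and [1 <= n / D] absorbs the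
constant next to the logarithm: 24 * (4 + 25/4) = 246 and 24 * 25/4 = 150 are
both below 256. *)
Lemma remainder_le_rate (R : realType) (n D : nat) (k sigma L : R) :
  (0 < n)%N -> (0 < D <= n)%N -> 0 <= k -> 0 <= L ->
  4 * k * ((2 * sigma * Num.sqrt L) ^+ 2 * n%:R * (1 + Num.sqrt 2) ^+ 2) *
    (4 / D%:R + 25 / 4 * ((1 + ln n%:R) / n%:R)) <=
  4 * sigma ^+ 2 * k * L * (3 + 256 * (ln n%:R + n%:R / D%:R)).
Proof.
move=> n0 /andP[D0 Dn] k0 L0.
have N0 : 0 < n%:R :> R by rewrite ltr0n.
have D0' : 0 < D%:R :> R by rewrite ltr0n.
rewrite !exprMn [Num.sqrt L ^+ 2]sqr_sqrtr //.
set s := Num.sqrt 2; set c := 4 * sigma ^+ 2 * k * L.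
have c0 : 0 <= c.
  by do 3![apply: mulr_ge0 => //]; exact: sqr_ge0.
have s0 : 0 <= s by rewrite sqrtr_ge0.
have s2 : s ^+ 2 = 2 by rewrite sqr_sqrtr.
have sle : s <= 3 / 2.
  rewrite -(@ler_sqr R) ?nnegrE // ?s2; lra.
have -> : 4 * k * (2 ^+ 2 * sigma ^+ 2 * L * n%:R * (1 + s) ^+ 2) *
    (4 / D%:R + 25 / 4 * ((1 + ln n%:R) / n%:R)) =
  c * (4 * (1 + s) ^+ 2 * (4 * (n%:R / D%:R) + 25 / 4 * (1 + ln n%:R))).
  by rewrite /c; field; rewrite !gt_eqF.
apply: ler_wpM2l => //.
have r1 : 1 <= n%:R / D%:R :> R by rewrite ler_pdivlMr // mul1r ler_nat.
have l0 : 0 <= ln n%:R :> R by rewrite ln_ge0 // ler1n.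
have -> : (1 + s) ^+ 2 = 3 + 2 * s by rewrite sqrrD s2; ring.
set r := n%:R / D%:R in r1 *; set l := ln n%:R in l0 *.
nra.
Qed.

Lemma nlambdaE (R : realType) (n : nat) (sigma L : R) : (0 < n)%N -> 0 <= L ->
  n%:R * (2 * sigma * Num.sqrt (2 / n%:R * L)) =
  2 * sigma * Num.sqrt L * (Num.sqrt 2 * Num.sqrt n%:R).
Proof.
move=> n0 L0.
have N0 : 0 < n%:R :> R by rewrite ltr0n.
have r0 : 0 < Num.sqrt n%:R :> R by rewrite sqrtr_gt0.
rewrite sqrtrM ?divr_ge0 ?(ltW N0) // sqrtrM // sqrtrV ?(ltW N0) //.
have {1}<- : Num.sqrt n%:R ^+ 2 = n%:R :> R by rewrite sqr_sqrtr // ltW.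
by field; rewrite gt_eqF.
Qed.

Unset Implicit Arguments.
Set Strict Implicit.
Set Printing Implicit Defensive.

Theorem proposition3 (R : realType) (d : measure_display)
    (Omega : measurableType d) (P : probability Omega R)
    (n : nat) (hn : (0 < n)%N)
    (fstar : 'rV[R]_n) (sigma : R) (hsigma : 0 < sigma)
    (xi : 'I_n -> {RV P >-> R}) (hxi : isotropic_gaussian sigma xi)
    (y : Omega -> 'rV[R]_n) (hy : forall w, y w = fstar + \row_i xi i w)
    (delta : R) (hdelta : 0 < delta < 1)
    (lambda : R)
    (hlambda : lambda =
       2 * sigma * Num.sqrt (2 / n%:R * ln (n%:R / delta)))
    (fhat : Omega -> 'rV[R]_n)
    (hfhat : forall w, argmin (tv_objective lambda (y w)) (fhat w)) :
  exists E : set Omega,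
    [/\ measurable E,
        ((1 - 2 * delta)%:E <= P E)%E &
        forall w, E w -> forall T : {set 'I_n}, T != finset.set0 ->
          n%:R^-1 * sqnorm2 (fhat w - fstar) <=
            inf [set n%:R^-1 * sqnorm2 (fbar - fstar)
                     + 4 * lambda * tv_on (~: T) fbar
                | fbar in [set: 'rV[R]_n]]
            + 4 * sigma ^+ 2 * #|T|%:R * ln (n%:R / delta) / n%:R
              * tv_rate R T].
Proof.
have [delta0 delta1] := andP hdelta.
set L := ln (n%:R / delta).
have N0 : 0 < n%:R :> R by rewrite ltr0n.
have L0 : 0 <= L.
  by rewrite ln_ge0 // ler_pdivlMr // mul1r (le_trans (ltW delta1)) // ler1n.
have lambda0 : 0 <= lambda by rewrite hlambda !mulr_ge0 ?sqrtr_ge0 // ltW.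
have tau0 : 0 <= 2 * sigma * Num.sqrt L by rewrite !mulr_ge0 ?sqrtr_ge0 // ltW.
have [E [mE PE noise]] := interval_sums_event hn hsigma hdelta hxi.
exists E; split=> // w Ew T Tn0.
rewrite -lerBlDr; apply: lb_le_inf.
  by exists (n%:R^-1 * sqnorm2 (0 - fstar) + 4 * lambda * tv_on (~: T) 0); exists 0.
move=> _ [f _ <-]; rewrite lerBlDr.
have := hfhat w; rewrite hy => /(basic_inequality f hn lambda0) basic.
have tvd := tv_difference T f (fhat w).
have nl0 : 0 <= 2 * (n%:R * lambda) by rewrite !mulr_ge0 // ltW.
have compat := noise_compatibility_bound (fhat w - f) T hn tau0 (noise w Ew).
rewrite -nlambdaE // -/L -hlambda in compat.
have Dn : (0 < min_spacing T <= n)%N by rewrite min_spacing_gt0 // min_spacing_le.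
have rate := remainder_le_rate sigma hn Dn (ler0n R #|T|) L0.
have total := le_trans compat rate.
have tvd' := ler_wpM2l nl0 tvd.
have main : sqnorm2 (fhat w - fstar) <= sqnorm2 (f - fstar)
    + n%:R * (4 * lambda * tv_on (~: T) f)
    + 4 * sigma ^+ 2 * #|T|%:R * L * (3 + 256 * (ln n%:R + n%:R / (min_spacing T)%:R)).
  move: basic tvd' total; lra.
rewrite /tv_rate ler_pdivrMl // (le_trans main) // le_eqVlt; apply/orP; left.
by apply/eqP; field; rewrite !gt_eqF // ltr0n min_spacing_gt0.
Qed.
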